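(* Let $p$ be a prime and $\mathcal A\subseteq\mathbb N$ a finite or infinite set with $0\in\mathcal A$. For $n\ge0$ let $f_{\mathcal A,p}(n)$ be the number of ways to write $n=\sum_{k\ge0}\epsilon_kp^k$ with all $\epsilon_k\in\mathcal A$, let $F_{\mathcal A,p}(x)=\sum_{n\ge0}f_{\mathcal A,p}(n)x^n$ and $\phi_{\mathcal A}(x)=\sum_{a\in\mathcal A}x^a$. Then in $\mathbb F_p[[x]]$ (coefficients reduced modulo $p$), $$F_{\mathcal A,p}(x)^{p-1}\,\phi_{\mathcal A}(x)=1.$$
   Context: Representations are counted as sequences $(\epsilon_k)_{k\ge0}$ in $\mathcal A$ with finitely many nonzero terms. *)

(* Defs.v *)
From HB Require Import structures.
From mathcomp Require Import all_boot all_order all_algebra finmap.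
From mathcomp Require Import boolp classical_sets functions cardinality fsbigop.

Set Implicit Arguments.
Unset Strict Implicit.
Unset Printing Implicit Defensive.

Import GRing.Theory.

Local Open Scope classical_set_scope.
Local Open Scope ring_scope.

(* Formal power series R[[x]].  They are wrapped in a record because the bare
   function type nat -> R already carries the pointwise ring structure. *)
Record fps (R : Type) := FPS { coefs : nat -> R }.

Notation "{ 'fps' R }" := (fps R) (format "{ 'fps'  R }").

HB.instance Definition _ (R : Type) := gen_eqMixin {fps R}.
HB.instance Definition _ (R : Type) := gen_choiceMixin {fps R}.

Lemma fpsP (R : Type) (f g : {fps R}) : coefs f =1 coefs g -> f = g.
Proof. by case: f g => [f] [g] /= /funext ->. Qed.

Section FpsRing.
Variable R : comNzRingType.
Implicit Types f g h : {fps R}.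

Definition fps_zero : {fps R} := FPS (fun=> 0).
Definition fps_one : {fps R} := FPS (fun n => (n == 0%N)%:R).
Definition fps_opp f : {fps R} := FPS (fun n => - coefs f n).
Definition fps_add f g : {fps R} := FPS (fun n => coefs f n + coefs g n).
Definition fps_mul f g : {fps R} :=
  FPS (fun n => \sum_(i < n.+1) coefs f i * coefs g (n - i)%N).

Lemma fps_addA : associative fps_add.
Proof. by move=> f g h; apply: fpsP => n /=; rewrite addrA. Qed.

Lemma fps_addC : commutative fps_add.
Proof. by move=> f g; apply: fpsP => n /=; rewrite addrC. Qed.

Lemma fps_add0 : left_id fps_zero fps_add.
Proof. by move=> f; apply: fpsP => n /=; rewrite add0r. Qed.

Lemma fps_addN : left_inverse fps_zero fps_opp fps_add.
Proof. by move=> f; apply: fpsP => n /=; rewrite addNr. Qed.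

HB.instance Definition _ :=
  GRing.isZmodule.Build {fps R} fps_addA fps_addC fps_add0 fps_addN.

Definition fps_trunc n f : {poly R} := \poly_(i < n.+1) coefs f i.

Lemma coef_fps_trunc n f i : (i <= n)%N -> (fps_trunc n f)`_i = coefs f i.
Proof. by move=> le_in; rewrite coef_poly ltnS le_in. Qed.

Lemma fps_mul_trunc n f g i : (i <= n)%N ->
  coefs (fps_mul f g) i = (fps_trunc n f * fps_trunc n g)`_i.
Proof.
move=> le_in; rewrite coefM; apply: eq_bigr => j _.
have le_jn : (j <= n)%N by apply: leq_trans le_in; rewrite -ltnS.
by rewrite !coef_fps_trunc // (leq_trans (leq_subr _ _)).
Qed.

Lemma fps_mulC : commutative fps_mul.
Proof. by move=> f g; apply: fpsP => n; rewrite !(fps_mul_trunc _ _ (leqnn n)) mulrC. Qed.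

Lemma fps_mulA : associative fps_mul.
Proof.
move=> f g h; apply: fpsP => n; rewrite !(fps_mul_trunc _ _ (leqnn n)).
transitivity (fps_trunc n f * (fps_trunc n g * fps_trunc n h))`_n; last first.
  rewrite mulrA ![(_ * fps_trunc n h)`_n]coefM; apply: eq_bigr => i _.
  have le_in : (i <= n)%N by rewrite -ltnS.
  by rewrite (coef_fps_trunc _ le_in) (fps_mul_trunc _ _ le_in).
rewrite !coefM; apply: eq_bigr => i _.
have le_nin : (n - i <= n)%N by exact: leq_subr.
by rewrite (coef_fps_trunc _ le_nin) (fps_mul_trunc _ _ le_nin).
Qed.

Lemma fps_mul1 : left_id fps_one fps_mul.
Proof.
move=> f; apply: fpsP => n /=; rewrite big_ord_recl /= mul1r subn0.
by rewrite big1 ?addr0 // => i _; rewrite mul0r.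
Qed.

Lemma fps_mulDl : left_distributive fps_mul fps_add.
Proof.
move=> f g h; apply: fpsP => n /=; rewrite -big_split.
by apply: eq_bigr => i _; rewrite /= mulrDl.
Qed.

Lemma fps_one_neq0 : fps_one != 0.
Proof.
apply/eqP => /(congr1 (fun f : {fps R} => coefs f 0)) /= /eqP.
by rewrite oner_eq0.
Qed.

HB.instance Definition _ := GRing.Zmodule_isComNzRing.Build {fps R}
  fps_mulA fps_mulC fps_mul1 fps_mulDl fps_one_neq0.

End FpsRing.

(* The representations n = \sum_(k >= 0) e k * p ^ k with all digits in A. *)
Definition representations (A : set nat) (p n : nat) : set (nat -> nat) :=
  [set e | [/\ forall k, A (e k),
               finite_set [set k | e k <> 0%N] &
               n = \big[addn/0%N]_(k \in [set: nat]) (e k * p ^ k)%N]].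

(* fset_set sends infinite sets to fset0; this shows that the default value is
   never used in num_representations when p > 1. *)
Lemma finite_representations A p n : (1 < p)%N ->
  finite_set (representations A p n).
Proof.
move=> p_gt1.
pose ext (g : {ffun 'I_n.+1 -> 'I_n.+1}) (k : nat) : nat :=
  if insub k is Some i then g i else 0%N.
apply: (@sub_finite_set _ _ [set ext g | g in [set: {ffun 'I_n.+1 -> 'I_n.+1}]]);
  last exact/finite_image/finite_finset.
move=> e [_ fin_e n_eq].
have fin_s : finite_set ([set: nat] `&` (fun k => (e k * p ^ k)%N) @^-1` [set~ 0%N]).
  by apply: sub_finite_set fin_e => k [_ /=]; apply: contra_not => ->.
have le_n k : (e k * p ^ k <= n)%N.
  have [->|ek_neq0] := eqVneq (e k * p ^ k)%N 0%N; first by [].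
  rewrite n_eq (bigD1_seq k) ?leq_addr ?finite_support_uniq //=.
  by rewrite in_finite_support // inE; split=> //; apply/eqP.
have e_le k : (e k <= n)%N.
  by apply: leq_trans (le_n k); rewrite leq_pmulr // expn_gt0 ltnW.
exists [ffun i : 'I_n.+1 => inord (e i)] => //.
apply: funext => k; rewrite /ext; case: insubP => [i _ <-|].
  by rewrite ffunE inordK // ltnS.
rewrite -leqNgt => lt_nk; apply/eqP; rewrite eq_sym; apply: contraTT (le_n k).
rewrite -ltnNge -lt0n => ek_gt0.
apply: leq_trans (leq_pmull _ ek_gt0).
exact: ltn_trans lt_nk (ltn_expl k p_gt1).
Qed.

Definition num_representations (A : set nat) (p n : nat) : nat :=
  #|` fset_set (representations A p n)|.

Definition repr_series (R : comNzRingType) (A : set nat) (p : nat) : {fps R} :=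
  FPS (fun n => (num_representations A p n)%:R).

Definition set_series (R : comNzRingType) (A : set nat) : {fps R} :=
  FPS (fun n => (n \in A)%:R).

(* Main.v *)
(* Splitting off the digit e_0 of a representation gives F(x) = phi(x) F(x^p).
   Over F_p the Frobenius identity turns F(x^p) into F(x)^p, and F, having
   constant term 1, can be cancelled from F = phi F^p. *)

Require Import Defs.
From mathcomp Require Import all_boot all_algebra finmap finfield.
From mathcomp Require Import boolp classical_sets functions cardinality fsbigop.

Import GRing.Theory.

Local Open Scope ring_scope.

Section PowerSeries.
Variable R : comNzRingType.
Implicit Types f g : {fps R}.

(** Coefficients up to degree [n] of a power depend only on those of [f] up to [n]. This transfers
    questions about powers of series to polynomials. *)
Lemma coef_fps_exp n f k i : (i <= n)%N ->
  coefs (f ^+ k) i = (fps_trunc n f ^+ k)`_i.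
Proof.
elim: k i => [|k IHk] i le_in; first by rewrite !expr0 coef1.
rewrite !exprS coefM; apply: eq_bigr => j _.
have le_jn : (j <= n)%N by apply: leq_trans le_in; rewrite -ltnS.
by rewrite coef_fps_trunc // IHk // (leq_trans (leq_subr _ _)).
Qed.

(** Strong induction on the degree: since [f] has constant term 1, the coefficient of [f * g] at [n]
    is that of [g] plus a combination of the coefficients of [g] below [n]. *)
Lemma fps_mulfI f : coefs f 0 = 1 -> injective ( *%R f).
Proof.
move=> f0 g h eq_fgh; apply: fpsP => n.
elim/ltn_ind: n => n IHn.
have /= := congr1 (fun s => coefs s n) eq_fgh.
rewrite !big_ord_recl /= f0 !mul1r subn0 => /(canRL (addrK _)) ->.
apply/(canLR (addrK _)); congr (_ + _); apply: eq_bigr => i _.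
rewrite /bump /= add1n IHn // ltn_subrL ltnS leq0n /=.
exact: leq_trans (ltn_ord i).
Qed.

Definition fps_comp_Xn p f : {fps R} :=
  FPS (fun n => if (p %| n)%N then coefs f (n %/ p)%N else 0).

End PowerSeries.

(** After truncation at [n] this concerns a polynomial q: raising to the power p is additive in
    characteristic p and fixes each coefficient by Fermat's little theorem, so q(x)^p = q(x^p). *)
Lemma fps_Frobenius p (f : {fps 'F_p}) : prime p -> f ^+ p = fps_comp_Xn _ p f.
Proof.
move=> p_pr; have p_gt0 := prime_gt0 p_pr.
apply: fpsP => n; rewrite (coef_fps_exp _ _ _ _ _ (leqnn n)) /=.
set q := fps_trunc n f.
have pcharP : p \in [pchar {poly 'F_p}] by rewrite pchar_poly pchar_Fp.
have -> : q ^+ p = q \Po 'X^p.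
  have expFp (x : 'F_p) : x ^+ p = x by have := expf_card x; rewrite card_Fp.
  rewrite comp_polyE -[in LHS](coefK q) poly_def -(pFrobenius_autE pcharP).
  rewrite raddf_sum; apply: eq_bigr => i _ /=.
  by rewrite pFrobenius_autE exprZn expFp exprAC.
rewrite coef_comp_poly_Xn //; case: ifP => // _.
by rewrite coef_fps_trunc // leq_div.
Qed.

Definition digit_cons (a : nat) (e : nat -> nat) (k : nat) : nat :=
  if k is k'.+1 then e k' else a.

(** An explicit bound on the support turns the sum over all positions into an ordinary finite sum,
    where the lowest digit can be split off. *)
Lemma finite_digitsP (e : nat -> nat) :
  finite_set [set k | e k <> 0%N] <->
  exists N, forall k, (N <= k)%N -> e k = 0%N.
Proof.
split=> [fin_e | [N e0]].
  exists (\max_(k <- fset_set [set k | e k <> 0%N]) k).+1 => k.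
  apply: contraPP => ek; apply/negP; rewrite -ltnNge ltnS.
  apply: (@leq_bigmax_seq _ _ _ id k) => //.
  by rewrite in_fset_set // inE.
apply: sub_finite_set (finite_II N) => k /= ek.
by rewrite ltnNge; apply/negP => /e0.
Qed.

Lemma digit_sumE p (e : nat -> nat) N : (forall k, (N <= k)%N -> e k = 0%N) ->
  \big[addn/0%N]_(k \in [set: nat]) (e k * p ^ k)%N =
  (\sum_(k < N) e k * p ^ k)%N.
Proof.
move=> e0; rewrite (fsbig_ord _ N (fun k => e k * p ^ k)%N); apply/esym.
apply: fsbig_widen => // k [_ /= /negP]; rewrite -leqNgt => /e0 ->.
by rewrite mul0n.
Qed.

Lemma digit_consK (e : nat -> nat) : digit_cons (e 0%N) (e \o S) = e.
Proof. by apply: funext => -[]. Qed.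

(** Horner's rule: prepending the digit [a] changes the value m into a + m p. The condition [a <= n]
    is listed separately because [n - a] is truncated: for [a > n] it would be 0, which [p]
    divides. *)
Lemma representations_cons A p n a e : (0 < p)%N ->
  representations A p n (digit_cons a e) <->
  [/\ A a, (a <= n)%N, (p %| n - a)%N & representations A p ((n - a) %/ p) e].
Proof.
move=> p_gt0.
have sum_cons N : (forall k, (N <= k)%N -> e k = 0%N) ->
    \big[addn/0%N]_(k \in [set: nat]) (digit_cons a e k * p ^ k)%N =
    (a + (\big[addn/0%N]_(k \in [set: nat]) (e k * p ^ k)) * p)%N.
  move=> e0; rewrite (digit_sumE _ e N) // (digit_sumE _ (digit_cons a e) N.+1); last by case.
  rewrite big_ord_recl /= muln1 big_distrl /=; congr (_ + _)%N.
  by apply: eq_bigr => i _; rewrite expnSr mulnA.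
split.
  move=> [Ae /finite_digitsP[N e0] n_eq].
  have eN0 k : (N <= k)%N -> e k = 0%N.
    by move=> le_Nk; apply: (e0 k.+1); exact: leqW.
  rewrite (sum_cons N) // in n_eq.
  rewrite n_eq leq_addr addKn dvdn_mull // mulnK //; split=> //; first exact: (Ae 0%N).
  by split=> // [k|]; [exact: (Ae k.+1) | apply/finite_digitsP; exists N].
move=> [Aa le_an dvd_p [Ae /finite_digitsP[N e0] n_eq]]; split.
- by case.
- by apply/finite_digitsP; exists N.+1; case.
- by rewrite (sum_cons N) // -n_eq divnK // subnKC.
Qed.

Arguments representations_cons {A p n a e}.

(** Representations are sorted by their lowest digit. The right-hand side is shaped as the
    coefficient of x^n in phi(x) F(x^p). *)
Lemma num_representations_rec A p n : (1 < p)%N ->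
  num_representations A p n =
  (\sum_(a < n.+1) (nat_of_ord a \in A) *
     (if p %| n - a then num_representations A p ((n - a) %/ p) else 0))%N.
Proof.
move=> p_gt1; have p_gt0 := ltnW p_gt1.
have fin m := finite_representations A m p_gt1.
rewrite /num_representations card_fset_sum1.
(* The lowest digit of a representation of [n] is at most [n], so [inord] never falls back on its
   default value. *)
rewrite (partition_big (fun e : nat -> nat => inord (e 0%N) : 'I_n.+1) xpredT) //=.
apply: eq_bigr => a _.
have le_an : (a <= n)%N by rewrite -ltnS.
rewrite big_fset_condE -card_fset_sum1.
set X := [fset e in _ | _]%fset.
have X_repr e : reflect (representations A p n e /\ e 0%N = a) (e \in X).
  rewrite !inE /= in_fset_set //; apply: (iffP andP) => -[].
    rewrite inE => e_repr /eqP <-; split=> //; rewrite inordK //.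
    move: e_repr; rewrite -{1}(digit_consK e).
    by move=> /(representations_cons p_gt0)[].
  by rewrite inE => e_repr ->; split=> //; rewrite inord_val.
have [Aa|nAa] := boolP (nat_of_ord a \in A); last first.
  apply/eqP; rewrite cardfs_eq0; apply/eqP/fsetP => e; rewrite inE.
  apply/negP => /X_repr[[Ae _ _] e0]; move/negP: nAa; apply.
  by rewrite inE -e0.
case: ifP => [dvd_p|ndvd_p]; last first.
  apply/eqP; rewrite muln0 cardfs_eq0; apply/eqP/fsetP => e; rewrite inE.
  apply/negP => /X_repr[]; rewrite -{1}(digit_consK e).
  by move=> /(representations_cons p_gt0)[_ _ + _] ea; rewrite ea ndvd_p.
(* In the remaining case, prepending [a] is a bijection from the representations of [(n - a) %/ p]
   onto [X]. *)
have cons_inj : injective (digit_cons a).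
  by move=> e e' /funeqP ee'; apply: funext => k; exact: (ee' k.+1).
rewrite mul1n.
suff -> : X = (digit_cons a @` fset_set (representations A p ((n - a) %/ p)))%fset.
  by rewrite card_imfset.
apply/fsetP => e; apply/X_repr/imfsetP => [[e_repr e0]|[e' /=]].
  exists (e \o S); last by rewrite -e0 digit_consK.
  rewrite /= in_fset_set // inE -e0.
  move: e_repr; rewrite -{1}(digit_consK e).
  by move=> /(representations_cons p_gt0)[].
rewrite in_fset_set // inE => e'_repr ->; split=> //.
by apply/representations_cons; rewrite // inE in Aa *.
Qed.

(** This gives F the constant term 1. In a representation of 0 the lowest digit is 0 and the tail
    again represents 0, so induction on the position, for all [e] at once, kills every digit. *)
Lemma num_representations0 (A : set nat) p :
  (1 < p)%N -> A 0%N -> num_representations A p 0 = 1%N.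
Proof.
move=> p_gt1 A0; rewrite /num_representations.
suff -> : representations A p 0 = [set fun=> 0%N]%classic by rewrite fset_set1 cardfs1.
apply/seteqP; split=> [e e_repr|_ ->]; last first.
  split=> //; last by rewrite fsbig1.
  by apply/finite_digitsP; exists 0%N.
apply: funext => k; elim: k e e_repr => [|k IHk] e;
  rewrite -{1}(digit_consK e) => /(representations_cons (ltnW p_gt1))[_];
  rewrite leqn0 => /eqP e0 _; first by [].
by rewrite sub0n div0n => /IHk.
Qed.

Lemma repr_seriesE (R : comNzRingType) A p : (1 < p)%N ->
  repr_series R A p = set_series R A * fps_comp_Xn R p (repr_series R A p).
Proof.
move=> p_gt1; apply: fpsP => n /=.
rewrite num_representations_rec // natr_sum; apply: eq_bigr => a _.
by rewrite natrM; case: ifP.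
Qed.

Theorem theorem3p2 (p : nat) (A : set nat) (p_prime : prime p) (A0 : A 0%N) :
  repr_series 'F_p A p ^+ (p - 1) * set_series 'F_p A = 1.
Proof.
have p_gt1 := prime_gt1 p_prime.
apply: (@fps_mulfI _ (repr_series 'F_p A p)).
  by rewrite /= num_representations0.
(* The extra factor F raises the exponent [p - 1] to [p], so Frobenius applies and phi(x) F(x^p) =
   F(x) remains. *)
rewrite mulr1 mulrA -exprS subn1 prednK ?prime_gt0 // fps_Frobenius // mulrC.
by rewrite -repr_seriesE.
Qed.
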